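(* There is a sample size $m=m(\varepsilon,\alpha,\beta)=\mathcal{O}\!\left(\frac1{\varepsilon^2\alpha^2}\log\frac1\beta\right)$ such that, if the sample maintained by the Laplace Density Estimator consists of $m$ users from $\mathcal{U}$, then for every fixed input stream $\mathcal{S}$, $$\mathbb{P}\bigl(|\tilde d-d(\mathcal{S})|\ge\alpha\bigr)\le\beta,$$ where the probability space is over the random choices of the algorithm.
   Context: Streams: $\mathcal{U}$ is a finite universe of users (with $|\mathcal{U}|\ge m$); a data stream is a finite sequence $\mathcal{S}=(s_1,\dots,s_T)$ with $s_t\in\mathcal{U}$. The density $d(\mathcal{S})$ is the number of distinct users appearing in $\mathcal{S}$ divided by $|\mathcal{U}|$. Parameters: $0<\varepsilon\le\frac12$ and accuracy parameters $\alpha,\beta\in(0,1)$; the $\mathcal{O}$ is for $\varepsilon,\alpha,\beta\to0$, and its constant does not depend on $\mathcal{U}$ or $\mathcal{S}$. $\mathrm{Laplace}(\mu,s)$ denotes a random variable with density $\frac1{2s}e^{-|x-\mu|/s}$. Laplace Density Estimator (sample size $m$): sample a uniformly random subset $M\subseteq\mathcal{U}$ of $m$ users without replacement, ordered as $M[1],\dots,M[m]$; pick arbitrary reals $\mu_{init}<\mu_{upd}$ and set $b=\frac{\mu_{upd}-\mu_{init}}{\varepsilon}$; keep an array of reals $\mathbf{x}=[x_1\ \dots\ x_m]$, with entries initialized independently as $x_i\sim\mathrm{Laplace}(\mu_{init},b)$. For $t=1,\dots,T$: if $s_t=M[i]$ for some $i$, re-sample $x_i\sim\mathrm{Laplace}(\mu_{upd},b)$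 (with fresh randomness). At the end output $$\tilde d=\frac1{\mu_{upd}-\mu_{init}}\Bigl(\frac1m\sum_{i=1}^m x_i-\mu_{init}\Bigr)+\mathrm{Laplace}\bigl(0,\tfrac1{\varepsilon m}\bigr),$$ with the last term independent of everything else. *)

(* Defs.v *)
From mathcomp Require Import all_boot all_order all_algebra.
From mathcomp Require Import all_classical all_reals all_analysis.

Set Implicit Arguments.
Unset Strict Implicit.
Unset Printing Implicit Defensive.

Import Order.TTheory GRing.Theory Num.Theory.
Import numFieldNormedType.Exports.

Local Open Scope classical_set_scope.
Local Open Scope ring_scope.

Definition density (R : realType) (U : finType) (S : seq U) : R :=
  #|[set u in S]%SET|%:R / #|U|%:R.

Definition laplace_pdf (R : realType) (mu s x : R) : R :=
  (2 * s)^-1 * expR (- (`|x - mu| / s)).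

Definition has_pdf d (Omega : measurableType d) (R : realType)
    (P : probability Omega R) (X : {RV P >-> R}) (f : R -> R) : Prop :=
  forall B : set R, measurable B ->
    distribution P X B = (\int[lebesgue_measure]_(x in B) (f x)%:E)%E.

Definition laplace_distributed d (Omega : measurableType d) (R : realType)
    (P : probability Omega R) (X : {RV P >-> R}) (mu s : R) : Prop :=
  has_pdf X (laplace_pdf mu s).

(* Independence is stated for event systems rather than random variables, so
   that variables with values in different types can occur in one family. *)
Definition mutually_independent d (Omega : measurableType d) (R : realType)
    (P : probability Omega R) (I : finType) (F : I -> set_system Omega) : Prop :=
  forall (J : {set I}) (E : I -> set Omega),
    (forall i, i \in J -> F i (E i)) ->
    P (\bigcap_(i in [set` J]) E i) = (\prod_(i in J) P (E i))%E.

(* The random choices made by the estimator on a stream of length T.  The fresh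
   value drawn at time t, if any, is [upd_noise t]; drawing it also when the
   t-th element is not sampled is harmless, since it is then never read. *)
Record random_choices d (Omega : measurableType d) (R : realType)
    (P : probability Omega R) (U : finType) (m T : nat) := RandomChoices {
  sample : Omega -> m.-tuple U ;
  init_noise : 'I_m -> {RV P >-> R} ;
  upd_noise : 'I_T -> {RV P >-> R} ;
  out_noise : {RV P >-> R} }.

Definition choice_events d (Omega : measurableType d) (R : realType)
    (P : probability Omega R) (U : finType) (m T : nat)
    (c : random_choices P U m T) (i : unit + 'I_m + 'I_T + unit) :
    set_system Omega :=
  match i with
  | inl (inl (inl _)) => preimage_set_system setT (sample c) setT
  | inl (inl (inr j)) => preimage_set_system setT (init_noise c j) measurable
  | inl (inr t) => preimage_set_system setT (upd_noise c t) measurable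
  | inr _ => preimage_set_system setT (out_noise c) measurable
  end.

(* The set of sampled users is uniform among the subsets of size m; nothing is
   assumed on the order in which [sample] lists them. *)
Record choices_spec d (Omega : measurableType d) (R : realType)
    (P : probability Omega R) (U : finType) (m T : nat) (eps mu_init mu_upd : R)
    (c : random_choices P U m T) : Prop := ChoicesSpec {
  sample_measurable : forall s : m.-tuple U, measurable (sample c @^-1` [set s]) ;
  sample_uniq : forall omega, uniq (sample c omega) ;
  sample_uniform : forall A : {set U}, #|A| = m ->
    P [set omega | [set u in sample c omega]%SET = A]
      = ('C(#|U|, m)%:R^-1 : R)%:E ;
  init_noise_laplace : forall i,
    laplace_distributed (init_noise c i) mu_init ((mu_upd - mu_init) / eps) ;
  upd_noise_laplace : forall t,
    laplace_distributed (upd_noise c t) mu_upd ((mu_upd - mu_init) / eps) ;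
  out_noise_laplace : laplace_distributed (out_noise c) 0 (eps * m%:R)^-1 ;
  choices_independent : mutually_independent P (choice_events c) }.

Definition process (R : realType) (U : finType) (m : nat) (M : m.-tuple U)
    (x : {ffun 'I_m -> R}) (sy : U * R) : {ffun 'I_m -> R} :=
  [ffun i => if tnth M i == sy.1 then sy.2 else x i].

Definition final_array d (Omega : measurableType d) (R : realType)
    (P : probability Omega R) (U : finType) (m T : nat) (S : T.-tuple U)
    (c : random_choices P U m T) (omega : Omega) : {ffun 'I_m -> R} :=
  foldl (process (sample c omega)) [ffun i => init_noise c i omega]
    [seq (tnth S t, upd_noise c t omega) | t <- enum 'I_T].

Definition laplace_estimate d (Omega : measurableType d) (R : realType)
    (P : probability Omega R) (U : finType) (m T : nat) (mu_init mu_upd : R)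
    (S : T.-tuple U) (c : random_choices P U m T) (omega : Omega) : R :=
  (mu_upd - mu_init)^-1 *
    (m%:R^-1 * (\sum_(i < m) final_array S c omega i) - mu_init)
  + out_noise c omega.

(* Main.v *)
(* Conditionally on the sample [M], distinct sampled users read distinct noise
   variables, so [m * (estimate - density)] is [k - m * density], where [k]
   counts the sampled users that occur in the stream, plus a sum of [m.+1]
   independent centred Laplace variables of scale [1 / eps].  One Chernoff bound
   handles everything: the moment generating function of each Laplace variable
   at [t] is [1 / (1 - (t / eps)^2)], and that of the hypergeometric variable
   [k] is dominated by the binomial one.  Taking [t = eps^2 * alpha / 10] gives
   a tail of at most [2 * exp (- m * eps^2 * alpha^2 / 20)]. *)
Require Import Defs.
From mathcomp Require Import all_boot all_order all_algebra.
From mathcomp Require Import all_classical all_reals all_analysis.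
From mathcomp Require Import measurable_realfun ring lra.

Set Implicit Arguments.
Unset Strict Implicit.
Unset Printing Implicit Defensive.

Import Order.TTheory GRing.Theory Num.Theory.
Import numFieldNormedType.Exports.

Local Open Scope classical_set_scope.
Local Open Scope ring_scope.

(** * Moment generating function of the Laplace distribution *)

Lemma continuous_expR_affine (R : realType) (a b : R) :
  continuous (fun x : R => expR (a * (x - b))).
Proof.
move=> x; apply: continuous_comp; last exact: continuous_expR.
apply: continuousM; first exact: cst_continuous.
by apply: continuousB; [exact: cvg_id|exact: cst_continuous].
Qed.

Lemma measurable_expR_affine (R : realType) (a b : R) :
  measurable_fun setT (fun x : R => expR (a * (x - b))).
Proof. by apply: continuous_measurable_fun; exact: continuous_expR_affine. Qed.

Lemma integral_expR_ray (R : realType) (a b : R) : 0 < a ->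
  (\int[lebesgue_measure]_(x in `[b, +oo[) (expR (- a * (x - b)))%:E
    = (a^-1)%:E)%E.
Proof.
move=> a0.
rewrite (@ge0_continuous_FTC2y _ _
  (fun x => - a^-1 * expR (- a * (x - b))) _ 0)//.
- by rewrite subrr mulr0 expR0 mulr1 -EFinD sub0r opprK.
- by apply: continuous_subspaceT; exact: continuous_expR_affine.
- suff : - a^-1 * expR (- a * (x - b)) @[x --> +oo] --> - a^-1 * (0 : R).
    by rewrite mulr0.
  apply: cvgM; first exact: cvg_cst.
  rewrite (_ : (fun x => expR _) =
               (fun z => expR (- z)) \o (fun x => a * (x - b))); last first.
    by apply: eq_fun => x; rewrite mulNr.
  apply: (@cvg_comp _ _ _ _ _ _ (pinfty_nbhs R)); last exact: cvgr_expR.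
  apply: gt0_cvgMry a0 _.
  apply/cvgryPge => M; near=> x; rewrite lerBrDr; near: x.
  exact: nbhs_pinfty_ge.
- apply/cvg_at_right_filter; apply: cvgM; first exact: cvg_cst.
  exact: continuous_expR_affine.
- move=> x _.
  have dl : is_derive x (1 : R) (fun x => - a * (x - b)) (- a).
    have := is_deriveZ (- a) 
      (is_deriveB (is_derive_id x (1 : R)) (is_derive_cst b x 1)).
    by rewrite subr0 /GRing.scale/= mulr1.
  have dF : is_derive x (1 : R) (fun x => - a^-1 * expR (- a * (x - b)))
     (expR (- a * (x - b))).
    have := is_deriveZ (- a^-1) (is_derive1_comp (is_derive_expR _) dl).
    by rewrite /GRing.scale/= mulrCA mulrNN mulVf ?gt_eqF// mulr1.
  by rewrite derive1E derive_val.
Unshelve. all: by end_near. Qed.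

Lemma integral_expR_rayN (R : realType) (a b : R) : 0 < a ->
  (\int[lebesgue_measure]_(x in `]-oo, b]) (expR (a * (x - b)))%:E
    = (a^-1)%:E)%E.
Proof.
move=> a0; rewrite -(integral_expR_ray (- b) a0) -{1}[b]opprK.
rewrite ge0_integration_by_substitutionNy//=.
- by apply: eq_integral => x _; congr (expR _)%:E; ring.
- by apply: continuous_subspaceT; exact: continuous_expR_affine.
Qed.

Lemma continuous_laplace_pdf (R : realType) (mu s : R) :
  continuous (laplace_pdf mu s).
Proof.
move=> x; rewrite /laplace_pdf; apply: cvgM; first exact: cvg_cst.
apply: continuous_comp; last exact: continuous_expR.
apply: continuousN; apply: continuousM; last exact: cst_continuous.
apply: continuous_comp; last exact: norm_continuous.
by apply: continuousB; [exact: cvg_id|exact: cst_continuous].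
Qed.

Lemma measurable_laplace_pdf (R : realType) (mu s : R) :
  measurable_fun setT (laplace_pdf mu s).
Proof. by apply: continuous_measurable_fun; exact: continuous_laplace_pdf. Qed.

Lemma laplace_pdf_ge0 (R : realType) (mu s x : R) : 0 < s ->
  0 <= laplace_pdf mu s x.
Proof.
by move=> s0; rewrite mulr_ge0 ?expR_ge0// invr_ge0 mulr_ge0// ltW.
Qed.

(** Splitting at [mu] leaves two exponential rays with rates [s^-1 + t] and [s^-1 - t], both
    positive because [|t| * s < 1]. The mean of the reciprocal rates, divided by [s], is the claimed
    fraction. *)
Lemma integral_laplace_mgf (R : realType) (mu s t : R) :
  0 < s -> `|t| * s < 1 ->
  (\int[lebesgue_measure]_x (expR (t * (x - mu)) * laplace_pdf mu s x)%:E
    = ((1 - (t * s) ^+ 2)^-1)%:E)%E.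
Proof.
move=> s0; rewrite -ltr_pdivlMr// div1r ltr_norml => /andP[t1 t2].
have a0 : 0 < s^-1 - t by rewrite subr_gt0.
have b0 : 0 < s^-1 + t by rewrite -(opprK t) subr_gt0 ltrNl.
set F := fun x : R => expR (t * (x - mu)) * laplace_pdf mu s x.
have F0 x : 0 <= F x by rewrite mulr_ge0 ?expR_ge0 ?laplace_pdf_ge0.
have cF : continuous F.
  by move=> x; apply: cvgM;
    [exact: continuous_expR_affine|exact: continuous_laplace_pdf].
have mF : measurable_fun setT F by exact: continuous_measurable_fun.
have mEF (A : set (measurableTypeR R)) : measurable_fun A (fun x => (F x)%:E).
  by apply/measurable_EFinP; exact: measurable_funTS.
rewrite -[X in integral _ X](setUv `]-oo, mu]%classic).
rewrite ge0_integral_setU//=; last 3 first.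
  by apply: measurableC; exact: measurable_itv.
  by move=> x _; exact: F0.
  exact/disj_setPCl.
rewrite setCitvl integral_itv_obnd_cbnd; last exact: mEF.
have c0 : 0 <= (2 * s)^-1 by rewrite invr_ge0 mulr_ge0// ltW.
transitivity (((2 * s)^-1)%:E *
    (\int[lebesgue_measure]_(x in `]-oo, mu])
       (expR ((s^-1 + t) * (x - mu)))%:E) +
  ((2 * s)^-1)%:E *
    (\int[lebesgue_measure]_(x in `[mu, +oo[)
       (expR (- (s^-1 - t) * (x - mu)))%:E))%E.
  have mE (A : set (measurableTypeR R)) a :
      measurable_fun A (fun x => (expR (a * (x - mu)))%:E).
    by apply/measurable_EFinP/measurable_funTS; exact: measurable_expR_affine.
  congr (_ + _)%E; rewrite -ge0_integralZl//.
  - apply: eq_integral => x; rewrite inE/= in_itv/= => xmu.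
    rewrite -EFinM /F /laplace_pdf ler0_norm ?subr_le0//.
    by rewrite mulrCA -expRD; congr (_ * expR _)%:E; ring.
  - apply: eq_integral => x; rewrite inE/= in_itv/= andbT => xmu.
    rewrite -EFinM /F /laplace_pdf ger0_norm ?subr_ge0//.
    by rewrite mulrCA -expRD; congr (_ * expR _)%:E; ring.
rewrite integral_expR_rayN// integral_expR_ray// -!EFinM -EFinD; congr EFin.
have : s != 0 by rewrite gt_eqF.
have : 1 - t * s != 0.
  by rewrite gt_eqF// subr_gt0 -ltr_pdivlMr// div1r.
have : 1 + t * s != 0.
  by rewrite gt_eqF// -(opprK (t * s)) subr_gt0 -mulNr -ltr_pdivlMr// div1r
     ltrNl.
move=> u v w.
have -> : s^-1 + t = (1 + t * s) / s by field.
have -> : s^-1 - t = (1 - t * s) / s by field.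
have -> : 1 - (t * s) ^+ 2 = (1 + t * s) * (1 - t * s) by ring.
by field; rewrite u v w.
Qed.

(** * Independent products *)

Section density.
Import HBNNSimple.

(** For indicators this is the hypothesis on [nu]; simple functions and monotone convergence give
    the rest. Having both a map [X] and a weight [w] lets it serve for Laplace densities ([X] the
    identity) and for the independence argument below ([w] the remaining factors of a product). *)
Lemma ge0_integral_density d d' (T : measurableType d) (T' : measurableType d')
    (R : realType) (mu : {measure set T -> \bar R})
    (nu : {measure set T' -> \bar R}) (X : T -> T') (w : T -> R)
    (g : T' -> \bar R) :
  measurable_fun setT X -> measurable_fun setT w -> (forall x, 0 <= w x) ->
  (forall B, measurable B -> nu B = \int[mu]_(x in X @^-1` B) (w x)%:E)%E ->
  measurable_fun setT g -> (forall y, 0 <= g y)%E ->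
  (\int[nu]_y g y = \int[mu]_x (g (X x) * (w x)%:E))%E.
Proof.
move=> mX mw w0 nuE mg g0.
pose h := nnsfun_approx measurableT mg.
have hE y : g y = limn (EFin \o h ^~ y).
  by apply/esym/cvg_lim => //; exact: cvg_nnsfun_approx.
have mhX n : measurable_fun setT (fun x => h n (X x)).
  by apply: measurableT_comp => //; exact: measurable_funP.
transitivity (limn (fun n => \int[nu]_y (h n y)%:E)%E).
  rewrite -monotone_convergence//.
  - by apply: eq_integral => y _; exact: hE.
  - by move=> n; exact/measurable_EFinP.
  - by move=> n y _; rewrite lee_fin.
  - by move=> y _ m n mn; rewrite lee_fin; exact/lefP/nd_nnsfun_approx.
transitivity (limn (fun n => \int[mu]_x ((h n (X x))%:E * (w x)%:E))%E);
  last first.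
  rewrite -monotone_convergence//.
  - apply: eq_integral => x _; apply/cvg_lim => //.
    apply: cvgeZr => //; exact: cvg_nnsfun_approx.
  - by move=> n; apply: emeasurable_funM; exact/measurable_EFinP.
  - by move=> n x _; rewrite mule_ge0// lee_fin.
  - move=> x _ m n mn.
    by rewrite lee_wpmul2r ?lee_fin//; exact/lefP/nd_nnsfun_approx.
apply: congr_lim; apply/funext => n.
rewrite integralT_nnsfun sintegralE.
have mhy y : measurable (X @^-1` (h n @^-1` [set y])).
  by rewrite -[X in measurable X]setTI; apply: mX => //;
    exact: measurable_funPTI.
under [RHS]eq_integral => x _.
  rewrite [X in (X * _)%E](_ : _ = (\sum_(y \in range (h n))
     (y * \1_(h n @^-1` [set y]) (X x))%:E)%E); last first.
    by rewrite fsumEFin// -(fimfunE _ (X x)).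
  rewrite ge0_mule_fsuml; last by move=> y; exact: nnfun_muleindic_ge0.
  over.
rewrite ge0_integral_fsum//; last 2 first.
  - move=> y; apply: emeasurable_funM; last exact/measurable_EFinP.
    apply/measurable_EFinP; apply: measurable_funM => //.
    by apply: (measurable_indic (mhy y)).
  - by move=> y x _; rewrite mule_ge0 ?lee_fin//; exact: nnfun_muleindic_ge0.
apply: eq_fsbigr => y; rewrite inE => -[z _ <-{y}].
rewrite nuE; last exact: measurable_funPTI.
under [RHS]eq_integral do rewrite EFinM -muleA.
rewrite ge0_integralZl//; last 3 first.
  - apply: emeasurable_funM; last exact/measurable_EFinP.
    by apply/measurable_EFinP; exact: (measurable_indic (mhy (h n z))).
  - by move=> x _; rewrite mule_ge0// lee_fin.
  - by rewrite lee_fin.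
congr (_ * _)%E; rewrite integral_mkcond; apply: eq_integral => x _.
by rewrite epatch_indic muleC.
Qed.

End density.

(** Independence is known for events only, so the factors are peeled off one at a time. The event
    that [X i] lies in [B] joins the family [J], and the induction hypothesis shows that the
    remaining product, integrated over it, is a constant times the law of [X i] at [B]; the product
    thus acts as a density. The events [E] later carry the conditioning on the sample. *)
Lemma integral_prod_independent d (Omega : measurableType d) (R : realType)
    (P : probability Omega R) (I : finType) (F : I -> set_system Omega)
    (X : I -> {RV P >-> R}) (g : I -> R -> R) (e : I -> R)
    (r : seq I) (J : {set I}) (E : I -> set Omega) :
  mutually_independent P F ->
  (forall i, measurable_fun setT (g i)) -> (forall i x, 0 <= g i x) ->
  uniq r -> (forall i, i \in r -> i \notin J) ->
  (forall i, i \in r -> forall B, measurable B -> F i (X i @^-1` B)) ->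
  (forall i, i \in r -> \int[P]_w (g i (X i w))%:E = (e i)%:E)%E ->
  (forall j, j \in J -> F j (E j) /\ measurable (E j)) ->
  (\int[P]_(w in \bigcap_(j in [set` J]) E j) (\prod_(i <- r) g i (X i w))%:E
    = (\prod_(j in J) P (E j)) * (\prod_(i <- r) e i)%:E)%E.
Proof.
move=> indep mg g0; elim: r J E => [|i r IH] J E.
  move=> _ _ _ _ FE; rewrite big_nil mule1 -indep; last by move=> j /FE[].
  under eq_integral do rewrite big_nil.
  rewrite integral_cst ?mul1e//; apply: fin_bigcap_measurable => //.
  by move=> j /= /FE[].
rewrite cons_uniq => /andP[ir ur] rJ rF re FE.
have iJ : i \notin J by apply: rJ; rewrite mem_head.
set A := \bigcap_(j in _) E j.
have mA : measurable A.
  by apply: fin_bigcap_measurable => // j /= /FE[].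
pose W w := \prod_(j <- r) g j (X j w).
have mW : measurable_fun setT W.
  apply: measurable_prod => j _; apply: measurableT_comp => //.
have W0 w : 0 <= W w by apply: prodr_ge0 => j _.
have e0 j : j \in i :: r -> 0 <= e j.
  by move=> /re je; rewrite -lee_fin -je integral_ge0// => w _; rewrite lee_fin.
pose c := fine (\prod_(j in J) P (E j))%E * \prod_(j <- r) e j.
have PE : (\prod_(j in J) P (E j))%E \is a fin_num.
  by apply: prode_fin_num => j /FE[_ mEj]; exact: fin_num_measure.
have c0 : 0 <= c.
  rewrite mulr_ge0//; first by rewrite fine_ge0// prode_ge0.
  by rewrite big_seq prodr_ge0// => j jr; rewrite e0// inE jr orbT.
have cE : (c%:E = (\prod_(j in J) P (E j)) * (\prod_(j <- r) e j)%:E)%E.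
  by rewrite EFinM fineK.
have mAW : measurable_fun setT (fun w => W w * \1_A w).
  by apply: measurable_funM => //; exact: (measurable_indic mA).
have AW0 w : 0 <= W w * \1_A w by rewrite mulr_ge0.
have WE (D : set Omega) : (\int[P]_(w in D) (W w * \1_A w)%:E =
    \int[P]_(w in D `&` A) (W w)%:E)%E.
  rewrite integral_mkcondr; apply: eq_integral => w _.
  by rewrite epatch_indic EFinM.
have density B : measurable B ->
  (mscale (NngNum c0) (distribution P (X i)) B =
   \int[P]_(w in X i @^-1` B) (W w * \1_A w)%:E)%E.
  move=> mB; pose E' j := if j == i then X i @^-1` B else E j.
  have E'J j : j \in J -> E' j = E j.
    by rewrite /E'; case: eqP => // ->; rewrite (negbTE iJ).
  rewrite WE.
  have -> : X i @^-1` B `&` A = \bigcap_(j in [set` (i |: J)%SET]) E' j.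
    rewrite [[set` _]](_ : _ = i |` [set` J]); last first.
      by apply/seteqP; split => j /=; rewrite in_setU1 => /predU1P.
    rewrite bigcap_setU1 {1}/E' eqxx; congr (_ `&` _).
    by apply: eq_bigcapr => j /= jJ; rewrite E'J.
  have mXB : measurable (X i @^-1` B).
    by rewrite -[X in measurable X]setTI; exact: measurable_funP.
  rewrite IH//.
  - rewrite big_setU1//= {1}/E' eqxx; under eq_bigr => j jJ do rewrite E'J//.
    by rewrite -muleA -cE /mscale/= muleC.
  - move=> j jr; rewrite in_setU1 negb_or rJ ?inE ?jr ?orbT// andbT.
    by apply: contraNneq ir => <-.
  - by move=> j jr; apply: rF; rewrite inE jr orbT.
  - by move=> j jr; apply: re; rewrite inE jr orbT.
  - move=> j; rewrite in_setU1 /E'; case: eqP => [-> _|_ /= /FE//].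
    by split=> //; apply: rF; rewrite ?mem_head.
have mgi : measurable_fun setT (EFin \o g i) by exact/measurable_EFinP.
have gi0 x : (0 <= (EFin \o g i) x)%E by rewrite lee_fin.
have := ge0_integral_density (measurable_funP (X i)) mAW AW0 density mgi gi0.
rewrite ge0_integral_mscale// ge0_integral_distribution//=.
rewrite re ?mem_head// => giE.
rewrite big_cons [in RHS]EFinM muleCA -cE muleC giE integral_mkcond.
apply: eq_integral => w _; rewrite epatch_indic/= big_cons !EFinM.
by rewrite muleA.
Qed.

(** * Sampling without replacement *)

(** Summed over all ordered pairs, the products of differences give twice the gap between the two
    sides. *)
Lemma chebyshev_sum (R : realFieldType) (T : finType) (D : {pred T})
    (f g : T -> R) :
  (forall a b, a \in D -> b \in D -> (f a - f b) * (g a - g b) <= 0) ->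
  #|D|%:R * \sum_(a in D) f a * g a
    <= (\sum_(a in D) f a) * (\sum_(a in D) g a).
Proof.
move=> fg.
have : \sum_(a in D) \sum_(b in D) (f a - f b) * (g a - g b) <= 0.
  by apply: sumr_le0 => a aD; apply: sumr_le0 => b bD; exact: fg.
have cst (x : R) : \sum_(b in D) x = #|D|%:R * x.
  by rewrite sumr_const mulr_natl.
have -> : \sum_(a in D) \sum_(b in D) (f a - f b) * (g a - g b) =
    2 * (#|D|%:R * (\sum_(a in D) f a * g a)
      - (\sum_(a in D) f a) * (\sum_(a in D) g a)).
  transitivity (\sum_(a in D) (#|D|%:R * (f a * g a)
      - f a * (\sum_(b in D) g b) - g a * (\sum_(b in D) f b)
      + \sum_(b in D) f b * g b)).
    apply: eq_bigr => a _; rewrite !mulr_sumr -cst -!sumrB -big_split/=.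
    by apply: eq_bigr => b _; ring.
  rewrite big_split/= !sumrB -mulr_sumr -!mulr_suml cst; ring.
by lra.
Qed.

(** By the geometric sum, [z ^+ k - 1] is [z - 1] times a nonnegative factor. Keeping [z - 1] in the
    statement covers both sides of 1 at once. *)
Lemma pow_comonotone (R : realFieldType) (z : R) (a b : nat) : 0 < z ->
  0 <= (z ^+ a - z ^+ b) * ((z - 1) * (a%:R - b%:R)).
Proof.
move=> z0; wlog ba : a b / (b <= a)%N => [hw|].
  case/orP: (leq_total b a) => [/hw//|/hw].
  by congr (0 <= _); ring.
rewrite -natrB// -{1}(subnK ba) exprD -{2}(mul1r (z ^+ b)) -mulrBl subrX1.
set s := \sum_(i < _) _; have s0 : 0 <= s.
  by apply: sumr_ge0 => i _; rewrite exprn_ge0// ltW.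
rewrite (_ : _ * _ = (z - 1) ^+ 2 * (s * z ^+ b * (a - b)%:R)); last by ring.
by rewrite mulr_ge0 ?sqr_ge0// !mulr_ge0// exprn_ge0// ltW.
Qed.

(** Double counting of pairs made of a set and one of its elements, through [B = u |: A]. *)
Lemma sum_card_setU1 (R : nmodType) (U : finType) (m : nat)
    (F : {set U} -> R) :
  \sum_(B : {set U} | #|B| == m.+1) \sum_(u in B) F B =
  \sum_(A : {set U} | #|A| == m) \sum_(u | u \notin A) F (u |: A)%SET.
Proof.
rewrite (exchange_big_dep predT)//= [RHS](exchange_big_dep predT)//=.
apply: eq_bigr => u _.
rewrite (reindex_onto (fun A : {set U} => u |: A)%SET (fun B => B :\ u)%SET).
  apply: eq_bigl => A; rewrite setU11 andbT cardsU1.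
  case: (boolP (u \in A)) => uA.
    rewrite andbF; apply/negbTE; rewrite negb_and orbC.
    apply/orP; left; apply: contraTneq uA => <-.
    by rewrite in_setD1 eqxx.
  by rewrite finset.setU1K// eqxx !andbT add1n eqSS.
by move=> B /andP[_ uB]; rewrite finset.setD1K.
Qed.

Lemma card_sets_notin (U : finType) (m : nat) (u : U) :
  #|[set A : {set U} | (#|A| == m) && (u \notin A)]%SET| = 'C(#|U|.-1, m).
Proof.
have -> : #|U|.-1 = #|[set~ u]%SET| by rewrite cardsC1.
rewrite -cards_draws.
apply: eq_card => A; rewrite !inE andbC; congr andb.
apply/idP/fintype.subsetP => [uA v vA|sub].
  by rewrite !inE; apply: contraNneq uA => <-.
by apply/negP => /sub; rewrite !inE eqxx.
Qed.

(** Double counting: each element of [S] is missed by ['C(#|U|.-1, m)] sets, and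
    [#|U| * 'C(#|U|.-1, m)] equals ['C(#|U|, m) * (#|U| - m)]. *)
Lemma sum_card_setD (R : realFieldType) (U : finType) (S : {set U}) (m : nat) :
  (0 < #|U|)%N ->
  \sum_(A : {set U} | #|A| == m) #|S :\: A|%SET%:R =
  'C(#|U|, m)%:R * (#|U| - m)%:R * (#|S|%:R / #|U|%:R) :> R.
Proof.
move=> U0.
transitivity
  (\sum_(A : {set U} | #|A| == m) \sum_(u in S | u \notin A) (1 : R)).
  apply: eq_bigr => A _; rewrite -sum1_card natr_sum.
  by apply: eq_bigl => u; rewrite !inE andbC.
rewrite (exchange_big_dep [in S])//=; last by move=> A u _ /andP[].
transitivity (\sum_(u in S) 'C(#|U|.-1, m)%:R : R).
  apply: eq_bigr => u uS; rewrite -(card_sets_notin m u) -sum1_card natr_sum.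
  by apply: eq_bigl => A; rewrite !inE uS.
rewrite sumr_const -mulr_natl.
have <- : (#|U| * 'C(#|U|.-1, m))%:R = 'C(#|U|, m)%:R * (#|U| - m)%:R :> R.
  rewrite -natrM; congr _%:R; case: #|U| U0 => // n _ /=.
  (* For [m] at least [#|U|] the truncated subtraction and the binomial coefficient both vanish. *)
  have [mn|nm] := leqP m n; last first.
    rewrite [in LHS]bin_small// (eqP (_ : n.+1 - m == 0)%N) ?subn_eq0//.
    by rewrite !muln0.
  by rewrite mul_bin_down mulnC subSn.
have U0' : #|U|%:R != 0 :> R by rewrite pnatr_eq0 -lt0n.
by rewrite natrM; field.
Qed.

(* Generating function of the hypergeometric distribution against that of the
   binomial one.  Passing from [m] to
   [m.+1] draws adds a factor that is negatively correlated with the number of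
   successes so far, whence Chebyshev's sum inequality. *)
Lemma hypergeometric_gf_le (R : realFieldType) (U : finType) (S : {set U})
    (m : nat) (z : R) : 0 < z ->
  \sum_(A : {set U} | #|A| == m) z ^+ #|A :&: S|%SET
    <= 'C(#|U|, m)%:R * (1 + (z - 1) * (#|S|%:R / #|U|%:R)) ^+ m.
Proof.
move=> z0; elim: m => [|m IH].
  rewrite bin0 expr0 mulr1 (eq_bigl (pred1 (@finset.set0 U))); last first.
    by move=> A; rewrite cards_eq0.
  by rewrite big_pred1_eq finset.set0I cards0.
have [Um|mU] := leqP #|U| m.
  rewrite bin_small// mul0r big_pred0// => A; apply/negbTE.
  by rewrite neq_ltn (leq_ltn_trans (max_card A))// ltnS.
have U0 : (0 < #|U|)%N by exact: leq_ltn_trans mU.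
set n := #|U|; set q := 1 + _.
have q0 : 0 <= q.
  have d0 : 0 <= #|S|%:R / #|U|%:R :> R by rewrite divr_ge0.
  have d1 : #|S|%:R / #|U|%:R <= 1 :> R.
    by rewrite ler_pdivrMr ?ltr0n// mul1r ler_nat max_card.
  rewrite /q; set d := _ / _ in d0 d1 *.
  have : 0 <= z * d by rewrite mulr_ge0// ltW.
  by lra.
(* [g A] sums the weights of the possible next draws after [A], so [f A * g A] produces the sets
   with one more element, each counted once per element. *)
pose f (A : {set U}) := z ^+ #|A :&: S|%SET.
pose g (A : {set U}) := \sum_(u | u \notin A) z ^+ (u \in S).
(* [g] is affine in [#|S :\: A|], hence in [#|A :&: S|] with slope [- (z - 1)]: this is the source
   of its negative correlation with [f]. *)
have gE (A : {set U}) : #|A| = m ->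
    g A = (n - m)%:R + (z - 1) * #|S :\: A|%SET%:R.
  move=> Am.
  have -> : g A = \sum_(u | u \notin A) (1 + (z - 1) * (u \in S)%:R).
    by apply: eq_bigr => u _; case: (u \in S); rewrite /= ?expr1 ?expr0; ring.
  rewrite big_split/= -mulr_sumr; congr (_ + _ * _).
    rewrite sumr_const (_ : #|_| = (n - m)%N)//.
    by rewrite -Am /n -[#|U|](cardC A) addKn; apply: eq_card => u; rewrite !inE.
  rewrite -natr_sum -sum1_card; congr _%:R.
  rewrite big_mkcond [RHS]big_mkcond; apply: eq_bigr => u _.
  by rewrite inE; case: (u \in A); case: (u \in S).
have rec : m.+1%:R * \sum_(A : {set U} | #|A| == m.+1) f A =
    \sum_(A : {set U} | #|A| == m) f A * g A.
  transitivity (\sum_(A : {set U} | #|A| == m.+1) \sum_(u in A) f A).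
    rewrite mulr_sumr; apply: eq_bigr => A /eqP Am.
    by rewrite sumr_const Am mulr_natl.
  rewrite sum_card_setU1; apply: eq_bigr => A /eqP Am.
  rewrite mulr_sumr; apply: eq_bigr => u uA.
  rewrite -exprD; congr (_ ^+ _); rewrite finset.setIUl addnC.
  case: (boolP (u \in S)) => uS.
    rewrite (_ : [set u] :&: S = [set u])%SET ?cardsU1 ?inE ?(negbTE uA)//=.
    by apply/finset.setIidPl; rewrite finset.sub1set.
  rewrite (_ : [set u] :&: S = finset.set0)%SET ?finset.set0U//.
  by apply/setP => v; rewrite !inE; case: eqP => // ->; rewrite (negbTE uS).
(* On average a further draw contributes the binomial factor [q], up to the number [n - m] of
   available elements. *)
have sumg : \sum_(A : {set U} | #|A| == m) g A =
    'C(n, m)%:R * (n - m)%:R * q.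
  rewrite (eq_bigr _ (fun A Am => gE A (eqP Am))) big_split/= -mulr_sumr.
  rewrite sum_card_setD// sumr_const.
  rewrite (_ : #|_| = 'C(n, m)); last first.
    by rewrite -card_draws; apply: eq_card => A; rewrite !inE.
  by rewrite -mulr_natl /q -/n; ring.
have C0 : 0 < 'C(n, m)%:R :> R by rewrite ltr0n bin_gt0 ltnW.
have := @chebyshev_sum R _ [pred A : {set U} | #|A| == m] f g.
rewrite (_ : #|_| = 'C(n, m)); last first.
  by rewrite -card_draws; apply: eq_card => A; rewrite !inE.
rewrite -rec sumg => cheb.
have {}cheb : m.+1%:R * \sum_(A : {set U} | #|A| == m.+1) f A <=
    (\sum_(A : {set U} | #|A| == m) f A) * ((n - m)%:R * q).
  rewrite -(ler_pM2l C0) [leRHS]mulrCA (mulrA 'C(n, m)%:R _ q).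
  apply: cheb.
  move=> A B /eqP Am /eqP Bm.
  rewrite !gE// /f.
  have eS (C : {set U}) : #|S :\: C|%SET%:R = #|S|%:R - #|C :&: S|%SET%:R :> R.
    by rewrite -(cardsID C S) finset.setIC natrD; ring.
  rewrite !eS; have := pow_comonotone #|A :&: S|%SET #|B :&: S|%SET z0.
  by lra.
rewrite -(ler_pM2l (_ : 0 < m.+1%:R)) ?ltr0n//; apply: le_trans cheb _.
have -> : m.+1%:R * ('C(n, m.+1)%:R * q ^+ m.+1) =
    'C(n, m)%:R * q ^+ m * ((n - m)%:R * q).
  rewrite mulrA -natrM mul_bin_left natrM exprSr; ring.
by apply: ler_wpM2r; [rewrite mulr_ge0|exact: IH].
Qed.

(** From [1 - t <= expR (- t)] comes [expR t <= 1 / (1 - t)], and [(1 - t) * (1 + t + 2 * t ^+ 2)]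
    exceeds 1 by [t ^+ 2 * (1 - 2 * t)]. *)
Lemma expR_le_quadratic (R : realType) (t : R) : `|t| <= 1 / 2 ->
  expR t <= 1 + t + 2 * t ^+ 2.
Proof.
rewrite ler_norml => /andP[t1 t2].
have e : (1 - t) * expR t <= 1.
  rewrite -[leRHS](expRxMexpNx_1 t) mulrC ler_wpM2l ?expR_ge0//.
  exact: expR_ge1Dx.
have t0 : 0 < 1 - t by lra.
rewrite -(ler_pM2l t0) (le_trans e)//.
have : 0 <= t ^+ 2 * (1 - 2 * t) by rewrite mulr_ge0 ?sqr_ge0//; lra.
by lra.
Qed.

(** Each binomial factor is at most [expR ((expR t - 1) * d)]. Centring removes the linear term, and
    the remaining [(expR t - 1 - t) * d] is at most [2 * t ^+ 2] since [0 <= d <= 1]. *)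
Lemma hypergeometric_mgf_le (R : realType) (U : finType) (S : {set U})
    (m : nat) (t : R) : `|t| <= 1 / 2 -> (m <= #|U|)%N ->
  'C(#|U|, m)%:R^-1 * \sum_(A : {set U} | #|A| == m)
      expR (t * (#|A :&: S|%SET%:R - m%:R * (#|S|%:R / #|U|%:R)))
    <= expR (2 * t ^+ 2 * m%:R).
Proof.
move=> ht mU; set d := _ / _.
have C0 : 0 < 'C(#|U|, m)%:R :> R by rewrite ltr0n bin_gt0.
have d0 : 0 <= d by rewrite divr_ge0.
have d1 : d <= 1.
  have [U0|U0] := posnP #|U|; first by rewrite /d U0 invr0 mulr0.
  by rewrite ler_pdivrMr ?ltr0n// mul1r ler_nat max_card.
rewrite mulrC ler_pdivrMr//.
have -> : \sum_(A : {set U} | #|A| == m)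
      expR (t * (#|A :&: S|%SET%:R - m%:R * d)) =
    (\sum_(A : {set U} | #|A| == m) expR t ^+ #|A :&: S|%SET) *
      expR (- t * d * m%:R).
  rewrite mulr_suml; apply: eq_bigr => A _.
  by rewrite -expRM_natr -expRD; congr expR; ring.
have := hypergeometric_gf_le S m (expR_gt0 t); rewrite -/d => gf.
apply: le_trans (ler_wpM2r (expR_ge0 _) gf) _.
rewrite -[leLHS]mulrA [leRHS]mulrC ler_pM2l// !expRM_natr -exprMn.
apply: lerXn2r; rewrite ?nnegrE ?expR_ge0//.
  rewrite mulr_ge0 ?expR_ge0//.
  have : 0 <= expR t * d by rewrite mulr_ge0 ?expR_ge0.
  by lra.
have q_le : 1 + (expR t - 1) * d <= expR ((expR t - 1) * d).
  exact: expR_ge1Dx.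
apply: le_trans (ler_wpM2r (expR_ge0 _) q_le) _.
rewrite -expRD ler_expR.
have h := expR_le_quadratic ht.
have : 0 <= d * (1 + t + 2 * t ^+ 2 - expR t) by rewrite mulr_ge0// subr_ge0.
have : 0 <= (1 - d) * t ^+ 2 by rewrite mulr_ge0 ?sqr_ge0// subr_ge0.
by lra.
Qed.

(** * The sample size *)

(** 20 is the Chernoff denominator, the summand 1 beside the logarithm pays for the two tails since
    [2 <= expR 1], and the successor rounds the truncation up and keeps the size positive. *)
Definition sample_size (R : realType) (eps alpha beta : R) : nat :=
  (Num.trunc (20 / (eps ^+ 2 * alpha ^+ 2) * (1 + ln (1 / beta)))).+1.

Lemma sample_size_bigO (R : realType) :
  (fun p : R * R * R => (sample_size p.1.1 p.1.2 p.2)%:R : R^o)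
    =O_ (filter_prod (filter_prod (0:R)^'+ (0:R)^'+) (0:R)^'+)
  (fun p : R * R * R => 1 / (p.1.1 ^+ 2 * p.1.2 ^+ 2) * ln (1 / p.2) : R^o).
Proof.
(* 41 = 20 * 2 + 1: for [beta < expR (-1)] the logarithm [L] is at least 1, so [1 + L <= 2 * L], and
   the 1 added by the successor is at most [L / w], as [w <= 1]. *)
apply/eqO_exP; exists 41; first by [].
have small (x : R) : 0 < x -> \forall y \near 0^'+, 0 < y < x.
  by move=> x0; near=> y; apply/andP; split; near: y;
    [exact: nbhs_right_gt|exact: nbhs_right_lt].
exists ([set p : R * R | 0 < p.1 < 1 /\ 0 < p.2 < 1],
  [set b : R | 0 < b < expR (-1)]).
  split => /=; last by apply: small; exact: expR_gt0.
  exists ([set e : R | 0 < e < 1], [set a : R | 0 < a < 1]).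
    by split => /=; apply: small.
  by move=> [e a] [].
move=> [[eps alpha] beta] [/= [/andP[e0 e1] /andP[a0 a1]] /andP[b0 b1]].
rewrite /sample_size; set L := ln (1 / beta).
have L1 : 1 <= L.
  rewrite /L div1r lnV ?posrE// lerNr -[leRHS]expRK ler_ln ?posrE ?expR_gt0//.
  exact: ltW.
set w := eps ^+ 2 * alpha ^+ 2.
have w0 : 0 < w by rewrite mulr_gt0// exprn_gt0.
have w1 : w <= 1 by rewrite mulr_ile1 ?exprn_ile1 ?exprn_ge0 ?ltW.
rewrite ger0_norm// ger0_norm; last by rewrite mulr_ge0 ?divr_ge0 ?ltW//; lra.
set y := 20 / w * (1 + L).
have iw1 : 1 <= w^-1 by rewrite invf_ge1.
have y0 : 0 <= y by rewrite /y !mulr_ge0 ?invr_ge0 ?ltW//; lra.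
have ty : (Num.trunc y)%:R <= y by rewrite truncn_le.
rewrite -natr1 div1r; apply: le_trans (_ : y + 1 <= _); first by rewrite lerD2r.
have : 0 <= w^-1 * (L - 1) by rewrite mulr_ge0 ?subr_ge0// ltW// lt_neqAle; lra.
rewrite /y; lra.
Unshelve. all: by end_near. Qed.

Lemma sample_size_ge (R : realType) (eps alpha beta : R) :
  0 < eps -> 0 < alpha -> 0 < beta ->
  1 + ln (1 / beta) <=
    (sample_size eps alpha beta)%:R * (eps ^+ 2 * alpha ^+ 2) / 20.
Proof.
move=> e0 a0 b0.
have w0 : 0 < eps ^+ 2 * alpha ^+ 2 by rewrite mulr_gt0// exprn_gt0.
have := truncnS_gt (20 / (eps ^+ 2 * alpha ^+ 2) * (1 + ln (1 / beta))).
rewrite -/(sample_size eps alpha beta) => /ltW.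
rewrite -(ler_pM2r w0) ler_pdivlMr//; apply: le_trans.
by rewrite le_eqVlt; apply/orP; left; apply/eqP; field; rewrite !gt_eqF.
Qed.

(** With [w = eps ^+ 2 * alpha ^+ 2], the exponent is at most
    [- m w / 10 + m w / 200 + (m + 1) w / 50], and [m + 1 <= 2 m] brings this below [- m w / 20].
    The 1 beside the logarithm then leaves [beta / expR 1], at most half of [beta]. *)
Lemma chernoff_exponent (R : realType) (eps alpha beta : R) (m : nat) :
  0 < eps <= 1 / 2 -> 0 < alpha < 1 -> 0 < beta -> (0 < m)%N ->
  1 + ln (1 / beta) <= m%:R * (eps ^+ 2 * alpha ^+ 2) / 20 ->
  forall t, t = eps ^+ 2 * alpha / 10 ->
  expR (- (t * m%:R * alpha)) * (expR (2 * t ^+ 2 * m%:R)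
    * (1 - (t / eps) ^+ 2)^-1 ^+ m.+1) <= beta / 2.
Proof.
move=> /andP[e0 e2] /andP[a0 a1] b0 m0 mL t tE.
have te : t / eps = eps * alpha / 10 by rewrite tE; field; rewrite gt_eqF.
set w := eps ^+ 2 * alpha ^+ 2 in mL *.
have ew : (t / eps) ^+ 2 = w / 100 by rewrite te /w; field.
have w0 : 0 <= w by rewrite mulr_ge0// sqr_ge0.
have ee : eps ^+ 2 <= 1 / 4.
  have : 0 <= (1 / 2 - eps) * (1 / 2 + eps) by rewrite mulr_ge0; lra.
  by lra.
have aa : alpha ^+ 2 <= 1 by rewrite exprn_ile1// ltW.
have w1 : w <= 1 / 4.
  by rewrite -[leRHS]mulr1 ler_pM// sqr_ge0.
(* With [x = w / 100] this is [1 / (1 - x) <= 1 + 2 * x <= expR (2 * x)], where the first bound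
   holds for [0 <= x <= 1 / 2]. *)
have G : (1 - (t / eps) ^+ 2)^-1 <= expR (2 * (w / 100)).
  rewrite ew -[leLHS]mul1r ler_pdivrMr; last by lra.
  apply: le_trans (ler_wpM2r _ (expR_ge1Dx _)); last by lra.
  have : 0 <= w * (50 - w) by rewrite mulr_ge0//; lra.
  by lra.
have {}G : (1 - (t / eps) ^+ 2)^-1 ^+ m.+1 <= expR (2 * (w / 100) * m.+1%:R).
  rewrite expRM_natr lerXn2r ?nnegrE ?expR_ge0// invr_ge0 ew; lra.
apply: le_trans (ler_wpM2l (expR_ge0 _) (ler_wpM2l (expR_ge0 _) G)) _.
rewrite -!expRD.
have t2 : t ^+ 2 <= w / 400.
  rewrite (_ : t ^+ 2 = w / 100 * eps ^+ 2); last by rewrite tE /w; field.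
  have : 0 <= w * (1 / 4 - eps ^+ 2) by rewrite mulr_ge0 ?subr_ge0.
  by lra.
have ta : t * alpha = w / 10 by rewrite tE /w; field.
have m1 : 1 <= m%:R :> R by rewrite ler1n.
have wm : 0 <= w * (m%:R - 1) by rewrite mulr_ge0// subr_ge0.
have tm : 0 <= (w / 400 - t ^+ 2) * m%:R by rewrite mulr_ge0// subr_ge0.
have wm0 : 0 <= w * m%:R by rewrite mulr_ge0.
apply: (@le_trans _ _ (expR (- (1 + ln (1 / beta))))).
  rewrite ler_expR (mulrAC t) ta -[m.+1%:R]natr1; lra.
rewrite opprD expRD div1r lnV ?posrE// opprK lnK ?posrE// mulrC.
rewrite ler_pM2l// expRN lef_pV2 ?posrE ?expR_gt0//.
exact: (expR_ge1Dx 1).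
Qed.

(** Measurability is asked of the pieces: on each fibre of the sample the estimate has an explicit
    formula that shows it. *)
Lemma measure_fibers d (T : measurableType d) (R : realType)
    (mu : {measure set T -> \bar R}) (K : finType) (f : T -> K) (D : set T) :
  (forall k, measurable (D `&` f @^-1` [set k])) ->
  (mu D = \sum_(k : K) mu (D `&` f @^-1` [set k]))%E.
Proof.
move=> mD.
rewrite {1}(_ : D = \bigcup_(k in [set: K]) (D `&` f @^-1` [set k]));
  last first.
  by apply/seteqP; split => [x Dx|x [k _ []//]]; exists (f x).
rewrite measure_fin_bigcup//; last 2 first.
- exact: finite_finset.
- by move=> i j _ _ [x [[_ /= <-] [_ /= <-]]].
rewrite (fsbigE (enum K)) ?enum_uniq//; last by move=> k _; rewrite mem_enum.
by rewrite big_enum_cond; apply: eq_bigl => k; rewrite in_setT.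
Qed.

(** * The estimator *)

Lemma foldl_process (R : realType) (U : finType) (m : nat) (M : m.-tuple U)
    (l : seq (U * R)) (x : {ffun 'I_m -> R}) (i : 'I_m) :
  foldl (process M) x l i = last (x i) [seq p.2 | p <- l & tnth M i == p.1].
Proof.
by elim: l x => //= -[u y] l IH x; rewrite IH ffunE/=; case: ifP.
Qed.

(* Index, in the family [choice_events], of the noise that the [i]-th entry of
   the array holds at the end of the stream. *)
Definition source (U : finType) (m T : nat) (S : T.-tuple U) (M : m.-tuple U)
    (i : 'I_m) : unit + 'I_m + 'I_T + unit :=
  last (inl (inl (inr i)))
    [seq inl (inr t) | t <- enum 'I_T & tnth M i == tnth S t].

Variant source_spec (U : finType) (m T : nat) (S : T.-tuple U) (M : m.-tuple U)
    (i : 'I_m) : unit + 'I_m + 'I_T + unit -> bool -> Prop :=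
| SourceUpd t of tnth S t = tnth M i : source_spec S M i (inl (inr t)) true
| SourceInit : source_spec S M i (inl (inl (inr i))) false.

(** Source and occurrence test are analysed together, so that one case split decides both whether
    the user of an entry occurs and around which mean the entry is centred. *)
Lemma sourceP (U : finType) (m T : nat) (S : T.-tuple U) (M : m.-tuple U)
    (i : 'I_m) : source_spec S M i (source S M i) (tnth M i \in S).
Proof.
rewrite /source; case: (boolP (tnth M i \in S)) => [/tnthP[t tE]|MiS].
  set l := [seq _ <- _ | _].
  have : t \in l by rewrite mem_filter mem_enum tE eqxx.
  have : {subset l <= [pred t | tnth M i == tnth S t]}.
    by move=> u; rewrite mem_filter => /andP[].
  case/lastP: l => // l u lu _; rewrite map_rcons last_rcons.
  by apply/SourceUpd/esym/eqP/(lu u); rewrite mem_rcons mem_head.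
rewrite (@eq_in_filter _ _ pred0) ?filter_pred0; last first.
  by move=> t _; apply/negbTE; apply: contraNneq MiS => ->; exact: mem_tnth.
exact: SourceInit.
Qed.

(** An update at time [t] belongs to the user [tnth S t], who has only one place in a duplicate-free
    sample; an initial value belongs to its own entry. *)
Lemma source_inj (U : finType) (m T : nat) (S : T.-tuple U) (M : m.-tuple U) :
  uniq M -> injective (source S M).
Proof.
move=> /tuple_uniqP uM i j.
case: sourceP => [t ti|]; case: sourceP => [t' tj|] // [] //.
by move=> tt'; apply: uM; rewrite -ti tt'.
Qed.

Lemma laplace_mgf d (Omega : measurableType d) (R : realType)
    (P : probability Omega R) (X : {RV P >-> R}) (mu s t : R) :
  laplace_distributed X mu s -> 0 < s -> `|t| * s < 1 ->
  (\int[P]_w (expR (t * (X w - mu)))%:E = ((1 - (t * s) ^+ 2)^-1)%:E)%E.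
Proof.
move=> XL s0 ts; rewrite -(integral_laplace_mgf mu s0 ts).
have mg : measurable_fun setT (fun x : R => (expR (t * (x - mu)))%:E).
  by apply/measurable_EFinP; exact: measurable_expR_affine.
rewrite -(ge0_integral_distribution X mg); last first.
  by move=> y; rewrite lee_fin expR_ge0.
rewrite (@ge0_integral_density _ _ _ _ R lebesgue_measure (distribution P X)
  idfun (laplace_pdf mu s))//.
- exact: measurable_id.
- exact: measurable_laplace_pdf.
- by move=> x; exact: laplace_pdf_ge0.
Qed.

(** On the event, one of the two exponentials is at least [expR (t * a)], according to the sign of
    [Y]. The restriction to [A] is for the fibres of the sample. *)
Lemma markov_expR d (Omega : measurableType d) (R : realType)
    (P : probability Omega R) (Y : Omega -> R) (A : set Omega) (t a : R) :
  measurable_fun setT Y -> measurable A -> 0 <= t ->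
  (P (A `&` [set w | (a <= `|Y w|)%R]) <= (expR (- (t * a)))%:E *
    (\int[P]_(w in A) (expR (t * Y w))%:E
     + \int[P]_(w in A) (expR (- t * Y w))%:E))%E.
Proof.
move=> mY mA t0.
have mE b : measurable_fun A (fun w => (expR (b * Y w))%:E).
  apply/measurable_EFinP/measurable_funTS; apply: measurableT_comp => //.
  by apply: measurable_funM.
have mB : measurable (A `&` [set w | a <= `|Y w|]).
  apply: (measurable_fun_le mA (measurable_cst a)).
  by apply: measurable_funTS; exact: measurableT_comp.
rewrite -ge0_integralD//.
have mS : measurable_fun A
    (fun w => ((expR (t * Y w))%:E + (expR (- t * Y w))%:E)%E).
  exact: emeasurable_funD.
have S0 w : (0 <= (expR (t * Y w))%:E + (expR (- t * Y w))%:E)%E.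
  by rewrite adde_ge0// lee_fin expR_ge0.
have mZ : measurable_fun A
    (fun w => (expR (- (t * a)))%:E
       * ((expR (t * Y w))%:E + (expR (- t * Y w))%:E))%E.
  exact: measurable_funeM.
have e0 : (0 <= (expR (- (t * a)))%:E)%E by rewrite lee_fin expR_ge0.
rewrite -ge0_integralZl// -[leLHS]mul1e -integral_cst//.
set B := A `&` _ in mB *; have BA : B `<=` A by exact: subIsetl.
apply: le_trans; last first.
  by apply: (@ge0_subset_integral _ _ _ P B A) => // w _; rewrite mule_ge0.
apply: ge0_le_integral => //.
- exact: measurable_funS mZ.
move=> w [_ /= aY]; rewrite -EFinD -EFinM lee_fin mulrDr -!expRD.
have taY : 0 <= - (t * a) + t * `|Y w|.
  by rewrite addrC -mulrBr mulr_ge0// subr_ge0.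
have /orP[Y0|Y0] := le_total 0 (Y w).
  rewrite (ger0_norm Y0) in taY.
  by rewrite -[leLHS]addr0 lerD ?expR_ge0// -expR0 ler_expR.
rewrite (ler0_norm Y0) mulrN -mulNr in taY.
by rewrite -[leLHS]add0r lerD ?expR_ge0// -expR0 ler_expR.
Qed.

Section estimator.
Context d (Omega : measurableType d) (R : realType) (P : probability Omega R)
  (U : finType) (m T : nat) (c : random_choices P U m T)
  (mu_init mu_upd eps : R) (S : T.-tuple U).

(** The index of the sample has no real variable; [out_noise] is a placeholder there, and
    [sources_neq_sample] keeps that index out of the sums. *)
Definition noise (i : unit + 'I_m + 'I_T + unit) : {RV P >-> R} :=
  match i with
  | inl (inl (inl _)) | inr _ => out_noise c
  | inl (inl (inr j)) => init_noise c j
  | inl (inr t) => upd_noise c t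
  end.

Definition center (i : unit + 'I_m + 'I_T + unit) : R :=
  match i with
  | inl (inl (inl _)) | inr _ => 0
  | inl (inl (inr j)) => mu_init
  | inl (inr t) => mu_upd
  end.

Lemma final_arrayE (M : m.-tuple U) (omega : Omega) (i : 'I_m) :
  sample c omega = M -> final_array S c omega i = noise (source S M i) omega.
Proof.
move=> ME; rewrite /final_array ME foldl_process ffunE filter_map -map_comp.
rewrite /source -(last_map (fun k => noise k omega)) -map_comp.
by congr last; apply: eq_map.
Qed.


(** Coefficients of the noises after multiplication of the error by [m]; they bring every noise to
    the common scale [1 / eps]. *)
Definition weight (i : unit + 'I_m + 'I_T + unit) : R :=
  if i is inr _ then m%:R else (mu_upd - mu_init)^-1.

Definition sources (M : m.-tuple U) : seq (unit + 'I_m + 'I_T + unit) :=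
  inr tt :: [seq source S M i | i <- enum 'I_m].

Definition hits (M : m.-tuple U) : nat :=
  #|[set u in M] :&: [set u in S]|%SET.

Definition error (M : m.-tuple U) (omega : Omega) : R :=
  (hits M)%:R - m%:R * density R S
  + \sum_(i <- sources M) weight i * (noise i omega - center i).

Lemma measurable_error (M : m.-tuple U) : measurable_fun setT (error M).
Proof.
apply: measurable_funD => //; apply: measurable_sum => i.
apply: measurable_funM => //; exact: measurable_funB.
Qed.

Context (m0 : (0 < m)%N) (eps0 : 0 < eps) (mu01 : mu_init < mu_upd)
  (cP : choices_spec eps mu_init mu_upd c).

Lemma hitsE (M : m.-tuple U) : uniq M ->
  (hits M)%:R = \sum_(i < m) (tnth M i \in S)%:R :> R.
Proof.
move=> uM; rewrite -natr_sum; congr _%:R.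
rewrite -(big_tuple _ _ M predT (fun u => nat_of_bool (u \in S)))/=.
rewrite big_uniq//= /hits -sum1_card big_mkcond [RHS]big_mkcond/=.
by apply: eq_bigr => u _; rewrite !inE; case: (u \in M); case: (u \in S).
Qed.

Lemma estimateE (M : m.-tuple U) (omega : Omega) : sample c omega = M ->
  m%:R * (laplace_estimate mu_init mu_upd S c omega - density R S)
    = error M omega.
Proof.
move=> ME; have uM : uniq M by rewrite -ME; exact: sample_uniq cP omega.
have mn0 : m%:R != 0 :> R by rewrite pnatr_eq0 -lt0n.
have D0 : mu_upd - mu_init != 0 by rewrite subr_eq0 gt_eqF.
rewrite /laplace_estimate /error (eq_bigr _ (fun i _ => final_arrayE i ME)).
rewrite /sources big_cons big_map big_enum/= subr0.
(* An entry is centred at [mu_upd] exactly when its user occurs in the stream, so the centres sum to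
   [m * mu_init] plus one gap [mu_upd - mu_init] per hit. *)
have -> : \sum_(i < m) noise (source S M i) omega =
    m%:R * mu_init + (mu_upd - mu_init) * (hits M)%:R
    + \sum_(i < m) (noise (source S M i) omega - center (source S M i)).
  rewrite hitsE// mulr_sumr mulr_natl -[in X in mu_init *+ X](card_ord m).
  rewrite -sumr_const -!big_split/=; apply: eq_bigr => i _.
  by case: sourceP => [t _|]/=; ring.
set N := \sum_(i < m) (_ - _).
have -> : \sum_(i < m) weight (source S M i) *
    (noise (source S M i) omega - center (source S M i)) =
    (mu_upd - mu_init)^-1 * N.
  by rewrite mulr_sumr; apply: eq_bigr => i _; case: sourceP.
by field; rewrite D0.
Qed.

Definition laplace_gf (t : R) : R := (1 - (t / eps) ^+ 2)^-1.

Lemma noise_mgf (M : m.-tuple U) (t : R) i : `|t| < eps -> i \in sources M ->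
  (\int[P]_w (expR (t * weight i * (noise i w - center i)))%:E
    = (laplace_gf t)%:E)%E.
Proof.
move=> te.
have D0 : 0 < mu_upd - mu_init by rewrite subr_gt0.
have mn0 : 0 < m%:R :> R by rewrite ltr0n.
have s0 : 0 < (mu_upd - mu_init) / eps by rewrite divr_gt0.
have ts : t * (mu_upd - mu_init)^-1 * ((mu_upd - mu_init) / eps) = t / eps.
  by field; rewrite !gt_eqF.
have to : t * m%:R * (eps * m%:R)^-1 = t / eps by field; rewrite !gt_eqF.
have te1 : `|t / eps| < 1.
  by rewrite normrM normfV (gtr0_norm eps0) ltr_pdivrMr// mul1r.
rewrite inE => /predU1P[->|/mapP[j _ ->]].
  rewrite (laplace_mgf (out_noise_laplace cP)) ?to// ?invr_gt0 ?mulr_gt0//.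
  by rewrite -[X in _ * X]gtr0_norm ?invr_gt0 ?mulr_gt0// -normrM to.
case: sourceP => [u _|] /=.
  rewrite (laplace_mgf (upd_noise_laplace cP u)) ?ts//.
  by rewrite -[X in _ * X]gtr0_norm// -normrM ts.
rewrite (laplace_mgf (init_noise_laplace cP j)) ?ts//.
by rewrite -[X in _ * X]gtr0_norm// -normrM ts.
Qed.

Lemma sources_neq_sample (M : m.-tuple U) i :
  i \in sources M -> i != inl (inl (inl tt)).
Proof.
by rewrite inE => /predU1P[->//|/mapP[j _ ->]]; case: sourceP.
Qed.

Lemma uniq_sources (M : m.-tuple U) : uniq M -> uniq (sources M).
Proof.
move=> uM; rewrite /= map_inj_uniq ?enum_uniq ?andbT; last exact: source_inj.
by apply/mapP => -[j _]; case: sourceP.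
Qed.

(** Once [M] is fixed the hit count is constant; the fibre of the sample is the only event, and the
    [m.+1] noises are the variables, fed to [integral_prod_independent]. *)
Lemma error_mgf (M : m.-tuple U) (t : R) : `|t| < eps -> uniq M ->
  (\int[P]_(w in sample c @^-1` [set M]) (expR (t * error M w))%:E =
   P (sample c @^-1` [set M]) *
     (expR (t * ((hits M)%:R - m%:R * density R S))
        * laplace_gf t ^+ m.+1)%:E)%E.
Proof.
move=> te uM; set A := sample c @^-1` _.
have mA : measurable A := sample_measurable cP M.
pose g (i : unit + 'I_m + 'I_T + unit) x :=
  expR (t * weight i * (x - center i)).
have mg i : measurable_fun setT (g i) by exact: measurable_expR_affine.
have g0 i x : 0 <= g i x by exact: expR_ge0.
have prodE : (\int[P]_(w in A) (\prod_(i <- sources M) g i (noise i w))%:E =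
    P A * (laplace_gf t ^+ m.+1)%:E)%E.
  have -> : laplace_gf t ^+ m.+1 = \prod_(i <- sources M) laplace_gf t.
    by rewrite big_const_seq count_predT iter_mulr_1/= size_map size_enum_ord.
  pose idx : unit + 'I_m + 'I_T + unit := inl (inl (inl tt)).
  have <- : (\prod_(j in [set idx]%SET) P A)%E = P A by rewrite big_set1.
  rewrite [X in integral _ X](_ : A = \bigcap_(j in [set` [set idx]%SET]) A).
    apply: (integral_prod_independent (choices_independent cP)) => //.
    - exact: uniq_sources.
    - by move=> i /sources_neq_sample; rewrite finset.in_set1.
    - move=> i /sources_neq_sample iidx B mB.
      by case: i iidx => [[[[]|j]|u]|[]]//= _; exists B; rewrite ?setTI.
    - by move=> i; exact: noise_mgf.
    - move=> j; rewrite finset.in_set1 => /eqP ->; split => //.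
      by exists [set M]; rewrite ?setTI.
  by apply/seteqP; split => [w Aw i _//|w]; apply; rewrite /= finset.in_set1.
have eE w : (expR (t * error M w))%:E =
    ((expR (t * ((hits M)%:R - m%:R * density R S)))%:E *
     (\prod_(i <- sources M) g i (noise i w))%:E)%E.
  rewrite -EFinM -expR_sum -expRD; congr (expR _)%:E.
  rewrite /error mulrDr mulr_sumr; congr (_ + _).
  by apply: eq_bigr => i _; rewrite mulrA.
under eq_integral do rewrite eE.
rewrite ge0_integralZl//.
- by rewrite prodE muleCA EFinM.
- apply/measurable_EFinP/measurable_funTS.
  by apply: measurable_prod => i _; exact: measurableT_comp.
- by move=> w _; rewrite lee_fin prodr_ge0.
Qed.

(** Only the law of the sampled set is specified, not that of the tuple listing it. Grouping the
    tuples by underlying set recovers the uniform law for functions of the set. *)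
Lemma sample_sum (phi : {set U} -> R) :
  \sum_(M : m.-tuple U | uniq M)
     fine (P (sample c @^-1` [set M])) * phi [set u in M]%SET
  = 'C(#|U|, m)%:R^-1 * \sum_(B : {set U} | #|B| == m) phi B.
Proof.
have mA (M : m.-tuple U) := sample_measurable cP M.
have setM (M : m.-tuple U) : uniq M -> #|[set u in M]%SET| = m.
  by move=> uM; rewrite cardsE (card_uniqP uM) size_tuple.
rewrite mulr_sumr (partition_big (fun M : m.-tuple U => [set u in M]%SET)
  (fun B => #|B| == m))/=; last by move=> M /setM ->.
apply: eq_bigr => B /eqP Bm.
rewrite (eq_bigr (fun M => fine (P (sample c @^-1` [set M])) * phi B));
  last first.
  by move=> M /andP[_ /eqP ->].
rewrite -mulr_suml; congr (_ * _); apply: EFin_inj.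
rewrite -(sample_uniform cP Bm) -sumEFin (measure_fibers _ (f := sample c)).
  rewrite big_mkcond; apply: eq_bigr => M _.
  case: ifPn => [/andP[uM /eqP MB]|MB].
    rewrite fineK ?fin_num_measure//; congr (P _).
    by apply/seteqP; split => [w /= wM|w []//]; split=> //=; rewrite wM.
  rewrite -[LHS](measure0 P); congr (P _).
  apply/esym/seteqP; split => // w [wB wM].
  move: MB => /negP; apply; rewrite -wM (sample_uniq cP)/=.
  by apply/eqP.
move=> M; have [MB|MB] := eqVneq [set u in M]%SET B.
  rewrite (_ : _ `&` _ = sample c @^-1` [set M])//.
  by apply/seteqP; split => [w []//|w /= wM]; split=> //=; rewrite wM.
rewrite (_ : _ `&` _ = set0)//; apply/seteqP; split => // w [/= wB wM].
by move: MB; rewrite -wM wB eqxx.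
Qed.

Lemma hits_mgf_le (t : R) : `|t| <= 1 / 2 -> (m <= #|U|)%N ->
  \sum_(M : m.-tuple U | uniq M) fine (P (sample c @^-1` [set M])) *
     expR (t * ((hits M)%:R - m%:R * density R S))
  <= expR (2 * t ^+ 2 * m%:R).
Proof.
move=> t2 mU.
rewrite (sample_sum (fun B => expR (t * (#|B :&: [set u in S]|%SET%:R
  - m%:R * density R S)))).
exact: hypergeometric_mgf_le.
Qed.

(** Markov's inequality and [error_mgf] apply on each fibre of the sample, and summing over the
    fibres averages the hit count through [hits_mgf_le]. The factor 2 collects the exponents [t] and
    [- t]. *)
Lemma estimate_tail (t alpha : R) :
  0 <= t < eps -> t <= 1 / 2 -> (m <= #|U|)%N ->
  (P [set w | (alpha <= `|laplace_estimate mu_init mu_upd S c w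
                          - density R S|)%R]
    <= (2 * (expR (- (t * m%:R * alpha)) * (expR (2 * t ^+ 2 * m%:R)
        * laplace_gf t ^+ m.+1)))%:E)%E.
Proof.
move=> /andP[t0 te] t2 mU; set D := [set w | _].
pose A M := sample c @^-1` [set M].
have mA (M : m.-tuple U) : measurable (A M) := sample_measurable cP M.
have mn0 : 0 < m%:R :> R by rewrite ltr0n.
have DA M : D `&` A M = A M `&` [set w | m%:R * alpha <= `|error M w|].
  rewrite setIC; apply/seteqP; split => w [AM /=]; split => //; move: b;
    rewrite -(estimateE AM) normrM gtr0_norm// ler_pM2l//.
rewrite (measure_fibers _ (f := sample c)); last first.
  move=> M; rewrite -/(A M) DA.
  apply: (measurable_fun_le (mA M) (measurable_cst _)).
  apply: measurable_funTS; apply: measurableT_comp => //.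
  exact: measurable_error.
set e := expR (- (t * m%:R * alpha)).
pose q M s := expR (s * ((hits M)%:R - m%:R * density R S)).
have DM (M : m.-tuple U) : (P (D `&` A M) <=
   (if uniq M then
      fine (P (A M)) * (e * ((q M t + q M (- t)) * laplace_gf t ^+ m.+1))
    else 0)%:E)%E.
  (* Tuples with repetitions are never sampled: their fibre is empty. *)
  case: ifPn => uM; last first.
    rewrite (_ : _ `&` _ = set0) ?measure0//.
    apply/seteqP; split => // w [_ wM].
    by move: uM; rewrite -wM (sample_uniq cP).
  rewrite DA.
  apply: le_trans (markov_expR P _ (measurable_error M) (mA M) t0) _.
  rewrite !error_mgf ?normrN ?ger0_norm//.
  have -> : laplace_gf (- t) = laplace_gf t by rewrite /laplace_gf mulNr sqrrN.
  rewrite -/(A M); move: (fineK (fin_num_measure P _ (mA M))).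
  set p := fine _ => <-; rewrite -!EFinM lee_fin.
  by rewrite /e /q mulrA le_eqVlt; apply/orP; left; apply/eqP; ring.
apply: le_trans (lee_sum _ (fun M _ => DM M)) _.
rewrite sumEFin lee_fin -big_mkcond/=.
rewrite (eq_bigr (fun M : m.-tuple U => (fine (P (A M)) * q M t
   + fine (P (A M)) * q M (- t)) * (e * laplace_gf t ^+ m.+1))); last first.
  by move=> M _; ring.
rewrite -mulr_suml big_split/=.
have h1 := @hits_mgf_le t; have h2 := @hits_mgf_le (- t).
rewrite normrN sqrrN ger0_norm// in h1 h2.
have G0 : 0 <= laplace_gf t ^+ m.+1.
  rewrite exprn_ge0// invr_ge0 subr_ge0 exprn_ile1 ?divr_ge0 ?(ltW eps0)//.
  by rewrite ler_pdivrMr// mul1r ltW.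
apply: le_trans (ler_wpM2r _ (lerD (h1 t2 mU) (h2 t2 mU))) _.
  by rewrite mulr_ge0// expR_ge0.
by rewrite le_eqVlt; apply/orP; left; apply/eqP; ring.
Qed.

End estimator.

Theorem theorem4p9 (R : realType) :
  exists m : R -> R -> R -> nat,
    (fun p : R * R * R => (m p.1.1 p.1.2 p.2)%:R : R^o)
      =O_ (filter_prod (filter_prod (0:R)^'+ (0:R)^'+) (0:R)^'+)
    (fun p : R * R * R => 1 / (p.1.1 ^+ 2 * p.1.2 ^+ 2) * ln (1 / p.2) : R^o)
  /\
    forall eps alpha beta : R,
      0 < eps <= 1 / 2 -> 0 < alpha < 1 -> 0 < beta < 1 ->
      (0 < m eps alpha beta)%N /\
      forall (U : finType), (m eps alpha beta <= #|U|)%N ->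
      forall (mu_init mu_upd : R), mu_init < mu_upd ->
      forall (T : nat) (S : T.-tuple U),
      forall (d : measure_display) (Omega : measurableType d)
        (P : probability Omega R)
        (c : random_choices P U (m eps alpha beta) T),
      choices_spec eps mu_init mu_upd c ->
      (P [set omega |
          (alpha <= `|laplace_estimate mu_init mu_upd S c omega - density R S|)%R]
        <= beta%:E)%E.
Proof.
exists (@sample_size R); split; first exact: sample_size_bigO.
move=> eps alpha beta heps halpha /andP[b0 b1]; split => //.
move=> U mU mu_init mu_upd mu01 T S d Omega P c cP.
have /andP[e0 e2] := heps; have /andP[a0 a1] := halpha.
pose t := eps ^+ 2 * alpha / 10.
(* Factoring out [eps] gives [t < eps], the range where the Laplace generating function is
   finite. *)
have tE : t = eps * (eps * alpha / 10) by rewrite /t; ring.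
have ea : 0 < eps * alpha by rewrite mulr_gt0.
have ea1 : eps * alpha <= 1 by rewrite mulr_ile1 ?ltW//; lra.
have t0 : 0 <= t by rewrite tE mulr_ge0 ?ltW// divr_gt0.
have te : t < eps by rewrite tE gtr_pMr//; lra.
have t2 : t <= 1 / 2 by lra.
apply: (le_trans (estimate_tail (t := t) S _ e0 mu01 cP alpha _ t2 mU)) => //.
  by rewrite t0 te.
rewrite lee_fin mulrC -ler_pdivlMr//.
by apply: (chernoff_exponent heps halpha b0) => //; exact: sample_size_ge.
Qed.
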